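(* Let $S_1$ be a state with at most one violinist per room. (i) If $S_2$ is obtained from $S_1$ by a move, then $B(S_2)$ is obtained from $B(S_1)$ by a suite move. (ii) Conversely, every suite-state obtained from $B(S_1)$ by a suite move equals $B(S_2)$ for some state $S_2$ obtained from $S_1$ by a move. (iii) In (i), the change of centroid $C(S_2)-C(S_1)$ equals the change of centroid from $B(S_1)$ to $B(S_2)$ under the corresponding suite move.
   Context: Rooms are indexed by the integers, room $i$ adjacent to $i\pm1$. A state is a finite placement of $N$ indistinguishable violinists in rooms, $a_i$ being the number in room $i$; room $i$ is occupied if $a_i\ge1$. A move: for two adjacent occupied rooms $i,i+1$, one violinist from room $i$ goes to the nearest unoccupied room to the left of $i$ and one from room $i+1$ goes to the nearest unoccupied room to the right of $i+1$. Moves from a state with at most one violinist per room again give such a state. The centroid of a state is $C=\frac1N\sum_i a_i\, i$. A suite-state is a finite sequence of nonnegative integers placed at consecutive integer positions (entry $b_p$ at position $p$), with total $N=\sum_p b_p$; its centroid is $\frac1N\sum_p b_p\,p$. A suite move: choose a position $p$ with $b_p=k>1$ and an integer $0<x<k$; set $b_p$ to $0$, add $x$ to the entry at position $p-1$ and $k-x$ to the entry at position $p+1$ (creating entries $0$ at new positions if needed), all other entries keeping their positions. For a state $S$ with at most one violinist per room, $B(S)$ is the suite-state obtained from its $0/1$ occupancy word (from leftmost to rightmost occupied room) by replacing each maximal block of $m$ consecutive $1$'s by the single entry $m$ and each maximal block of $j$ consecutive $0$'s by $j-1$ entries $0$ (e.g. $1011001\mapsto 1201$); suite-states are compared up to translation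 of positions. *)

(* Defs.v *)
From mathcomp Require Import all_boot all_order all_algebra finmap.

Set Implicit Arguments.
Unset Strict Implicit.
Unset Printing Implicit Defensive.

Import Order.TTheory GRing.Theory Num.Theory.
Local Open Scope ring_scope.

Definition state := {fsfun int -> nat with 0%N}.

Definition occupied (S : state) (i : int) : bool := (1 <= S i)%N.

Definition at_most_one (S : state) : Prop := forall i, (S i <= 1)%N.

Definition violinists (S : state) : nat := (\sum_(i <- finsupp S) S i)%N.

Definition centroid (S : state) : rat :=
  (\sum_(i <- finsupp S) (S i)%:R * i%:~R) / (violinists S)%:R.

Definition nearest_free_left (S : state) (i l : int) : Prop :=
  [/\ l < i, ~~ occupied S l & forall j : int, l < j -> j < i -> occupied S j].

Definition nearest_free_right (S : state) (i r : int) : Prop :=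
  [/\ i < r, ~~ occupied S r & forall j : int, i < j -> j < r -> occupied S j].

(* The truncated subtractions are exact: rooms i and i + 1 are occupied. *)
Definition move (S S' : state) : Prop :=
  exists i l r : int,
    [/\ occupied S i, occupied S (i + 1),
        nearest_free_left S i l, nearest_free_right S (i + 1) r &
        forall j : int, S' j = (S j - (j == i) - (j == i + 1)%R
                              + (j == l) + (j == r))%N].

(* The sequence [entries] is placed at positions
   [offset, offset + 1, ..., offset + size entries - 1]. *)
Record suite := Suite { offset : int; entries : seq nat }.

(* One past the last position. *)
Definition suite_end (T : suite) : int := offset T + (size (entries T))%:Z.

Definition entry (T : suite) (p : int) : nat :=
  if offset T <= p then nth 0%N (entries T) `|p - offset T|%N else 0%N.

Definition suite_total (T : suite) : nat := sumn (entries T).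

Definition suite_centroid (T : suite) : rat :=
  (\sum_(k < size (entries T))
      (nth 0%N (entries T) k)%:R * (offset T + k%:Z)%:~R) / (suite_total T)%:R.

(* The conditions on [offset] and [suite_end] say that the sequence is extended
   exactly as far as needed to contain the positions p - 1 and p + 1. *)
Definition suite_move (T T' : suite) : Prop :=
  exists (p : int) (k x : nat),
    [/\ entry T p = k, (1 < k)%N, (0 < x < k)%N,
        offset T' = Order.min (offset T) (p - 1) /\
        suite_end T' = Order.max (suite_end T) (p + 2) &
        forall q : int, entry T' q =
          if q == p then 0%N
          else if q == p - 1 then (entry T q + x)%N
          else if q == p + 1 then (entry T q + (k - x))%N
          else entry T q].

Definition translate (c : int) (T : suite) : suite :=
  Suite (offset T + c) (entries T).

Definition same_suite (T U : suite) : Prop := exists c : int, T = translate c U.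

Definition occupancy_word (S : state) : seq bool :=
  if sort <=%R (finsupp S : seq int) is x :: s then
    [seq occupied S (x + k%:Z) | k <- iota 0 (`|last x s - x|%N).+1]
  else [::].

(* Maximal blocks of equal letters, with their lengths. *)
Fixpoint runs (w : seq bool) : seq (bool * nat) :=
  if w is b :: w' then
    match runs w' with
    | (c, m) :: t => if b == c then (c, m.+1) :: t else (b, 1%N) :: (c, m) :: t
    | [::] => [:: (b, 1%N)]
    end
  else [::].

Definition suite_word (w : seq bool) : seq nat :=
  flatten [seq if r.1 then [:: r.2] else nseq r.2.-1 0%N | r <- runs w].

Example suite_word_1011001 :
  suite_word [:: true; false; true; true; false; false; true]
  = [:: 1; 2; 0; 1]%N.
Proof. by []. Qed.

(* The offset 0 is arbitrary: B(S) is only meaningful up to [same_suite]. *)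
Definition B (S : state) : suite := Suite 0 (suite_word (occupancy_word S)).

(* Main.v *)
Require Import Defs.
From mathcomp Require Import all_boot all_order all_algebra finmap.
From mathcomp Require Import zify lra.

(** A word starting and ending with [1] has the form
    [1^b_0 0 1^b_1 0 ... 0 1^b_n], and [B] sends it to [b_0 b_1 ... b_n]: a gap
    of [j] zeros is [j] separators around [j - 1] empty blocks.  A move inside
    the block of [k] ones, taking room [i] at distance [x] from the free room on
    its left, turns [1^c 0 1^k 0 1^d] into [1^(c+x) 0 0 1^(k-x+d)], which is the
    suite move [c k d -> (c+x) 0 (k-x+d)].  Padding with zeros on both sides
    reduces moves at the boundary to this case.  Both moves change the first
    moment by [k - 2x], and both have the same total. *)

Set Implicit Arguments.
Unset Strict Implicit.
Unset Printing Implicit Defensive.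

Import Order.TTheory GRing.Theory Num.Theory.
Local Open Scope ring_scope.

(** * Finite sequences placed on the integers *)

Section Window.
Variables (T : eqType) (d : T).
Implicit Types (a j : int) (s : seq T).

(** Used with default [false] for occupancy words and [0] for suites. As functions on all integers,
    sequences that differ only by padding become pointwise equal. *)
Definition window a s j : T := if a <= j then nth d s `|j - a|%N else d.

(** The empty sequence is excluded, since [head] and [last] then return [d]. *)
Definition tight s := (head d s != d) && (last d s != d).

Lemma window_nat a s (n : nat) : window a s (a + n%:Z) = nth d s n.
Proof. by rewrite /window ifT; [congr nth; lia | lia]. Qed.

Lemma window_neq a s j : window a s j != d -> a <= j < a + (size s)%:Z.
Proof.
rewrite /window; case: ifP; last by rewrite eqxx.
move=> aj; case: (ltnP `|j - a|%N (size s)) => [|/(nth_default d) ->]; first lia.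
by rewrite eqxx.
Qed.

Lemma window_ext a s s' : nth d s =1 nth d s' -> window a s =1 window a s'.
Proof. by move=> e j; rewrite /window; case: ifP. Qed.

Lemma window_cons a s : window a (d :: s) =1 window (a + 1) s.
Proof.
move=> j; rewrite /window; case: (ltgtP a j) => aj.
- rewrite ifT; last lia.
  by have ->: `|j - a|%N = `|j - (a + 1)%R|%N.+1 by lia.
- by rewrite ifF //; lia.
- by subst j; rewrite subrr ifF //=; lia.
Qed.

Lemma window_rcons a s : window a (rcons s d) =1 window a s.
Proof.
apply: window_ext => n; rewrite nth_rcons.
by case: ltngtP => // h; rewrite nth_default // ?h // ltnW.
Qed.

Lemma tight_offset a s : tight s -> window a s a != d.
Proof. by case/andP=> h _; rewrite -{2}[a]addr0 window_nat nth0. Qed.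

Lemma tight_end a s : tight s -> window a s (a + (size s)%:Z - 1) != d.
Proof.
case/andP=> _; case: s => [|y s] h; first by rewrite /= eqxx in h.
have ->: a + (size (y :: s))%:Z - 1 = a + (size s)%:Z by rewrite /=; lia.
by rewrite window_nat; rewrite (last_nth d) in h.
Qed.

Lemma tight_window a s :
  window a s a != d -> window a s (a + (size s)%:Z - 1) != d -> tight s.
Proof.
case: s => [|y s]; first by rewrite /window nth_nil if_same eqxx.
have ->: a + (size (y :: s))%:Z - 1 = a + (size s)%:Z by rewrite /=; lia.
by rewrite -{2}[a]addr0 !window_nat /tight (last_nth d) /= => -> ->.
Qed.

(** The two ends of a tight sequence are the extreme positions with a value other than [d], so the
    function determines the offset and the length, and then each term. *)
Lemma window_inj a a' s s' : tight s -> tight s' ->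
  window a s =1 window a' s' -> a = a' /\ s = s'.
Proof.
move=> ts ts' e.
have := tight_offset a ts; rewrite e => /window_neq h1.
have := tight_offset a' ts'; rewrite -e => /window_neq h2.
have := tight_end a ts; rewrite e => /window_neq h3.
have := tight_end a' ts'; rewrite -e => /window_neq h4.
have ea : a = a' by lia.
subst a'; split=> //; apply: (@eq_from_nth _ d); first by lia.
by move=> n _; rewrite -!(window_nat a) e.
Qed.

End Window.

(** * Block words and their inverse [suite_word] *)

(* The last block is also followed by a separator, which makes [block_word] a
   morphism; as a trailing [false] it is invisible to [window]. *)
Definition block_word (b : seq nat) : seq bool :=
  flatten [seq rcons (nseq m true) false | m <- b].

Lemma block_word_cat b c : block_word (b ++ c) = block_word b ++ block_word c.
Proof. by rewrite /block_word map_cat flatten_cat. Qed.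

Lemma block_word_cons m b :
  block_word (m :: b) = nseq m true ++ false :: block_word b.
Proof. by rewrite /block_word /= cat_rcons. Qed.

Lemma last_block_word b : last false (block_word b) = false.
Proof. by elim: b => // m b IH; rewrite block_word_cons last_cat. Qed.

(** The first [false] marks the end of the first block, so the entries can be read back one at a
    time. *)
Lemma block_word_inj : injective block_word.
Proof.
elim=> [|m b IH] [|n c] //.
- by rewrite block_word_cons; case: n.
- by rewrite block_word_cons; case: m.
rewrite !block_word_cons; elim: m n => [|m IHm] [|n] //= [].
  by move/IH ->.
by move/IHm => [-> ->].
Qed.

Lemma count_block_word b : count id (block_word b) = sumn b.
Proof.
elim: b => // m b IH.
by rewrite block_word_cons count_cat /= IH count_nseq mul1n.
Qed.

Lemma block_word_tight b : tight 0%N b ->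
  exists2 w, tight false w & block_word b = rcons w false.
Proof.
case/andP; case/lastP: b => // b [|m]; rewrite ?last_rcons // => h _.
exists (block_word b ++ nseq m.+1 true).
  rewrite /tight last_cat /=.
  have ->: last true (nseq m true) = true by elim: m {h}.
  by case: b h => [|[|n] b].
by rewrite -cats1 block_word_cat block_word_cons cats1 -rcons_cat -cats1 -!catA.
Qed.

Lemma runs_cons c w : exists m t, runs (c :: w) = (c, m.+1) :: t.
Proof.
rewrite /=; case: (runs w) => [|[c' m] t]; first by exists 0%N, [::].
by case: eqP => [<-|_]; [exists m, t | exists 0%N, ((c', m) :: t)].
Qed.

(** The induction passes through suffixes that start with zeros. A leading run of [j] zeros yields
    only [j - 1] separators, the missing one being the separator that closes the preceding block;
    hence [behead]. *)
Lemma block_word_suite_word_aux w : last false w ->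
  block_word (suite_word w) =
  if head false w then rcons w false else behead (rcons w false).
Proof.
elim: w => //= c [_|c' w IH]; first by case: c.
(* Only the outer step of [runs] is unfolded, so that [runs_cons] can expose the first run of the
   rest. *)
move=> /IH {IH}; rewrite /suite_word -[runs (c :: _)]/(match runs (c' :: w) with
    | (c'', m) :: t => if c == c'' then (c'', m.+1) :: t
                       else (c, 1%N) :: (c'', m) :: t
    | [::] => [:: (c, 1%N)] end).
have [m [t ->]] := runs_cons c' w.
case: c; case: c' => /=; rewrite ?block_word_cons //= => -> //.
Qed.

Lemma block_word_suite_word w : tight false w ->
  block_word (suite_word w) = rcons w false.
Proof.
by case/andP=> h l; rewrite block_word_suite_word_aux; [case: head h|case: last l].
Qed.

Lemma suite_word_tight w : tight false w -> tight 0%N (suite_word w).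
Proof.
move=> tw; have := block_word_suite_word tw; case/andP: tw.
case/lastP: w => // w x h; rewrite last_rcons; case: x h => // h _.
case/lastP: (suite_word _) => [|b m]; first by case: w {h}.
rewrite -cats1 block_word_cat block_word_cons /tight last_cat /= => e.
apply/andP; split.
  case: b e => [|n b]; rewrite ?block_word_cons /=.
    by case: m => // e; case: w e h => [|[]].
  by case: n => // e; case: w e h => [|[]].
(* A last entry [0] would make [block_word b] end in [true], which no block word does. *)
case: m e => // /eqP; rewrite cats1 eqseq_rcons => /andP[/eqP e _].
by have := last_block_word b; rewrite e last_rcons.
Qed.

(** * Encoding states by sequences of block lengths *)

Definition reads (S : state) (a : int) (w : seq bool) :=
  forall j, S j = window false a w j.

(** Zeros at the ends of [b] are allowed, so a state has many encodings; the tight one is unique. *)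
Definition encodes (S : state) (a : int) (b : seq nat) :=
  reads S a (block_word b).

Lemma reads_at_most_one S a w : reads S a w -> at_most_one S.
Proof. by move=> r i; rewrite r leq_b1. Qed.

Lemma occupiedE S i : at_most_one S -> S i = occupied S i.
Proof. by move=> /(_ i); rewrite /occupied; case: (S i) => [|[]]. Qed.

Lemma mem_finsupp_occupied (S : state) i : (i \in finsupp S) = occupied S i.
Proof. by rewrite mem_finsupp -lt0n. Qed.

(** The sorted support runs from the leftmost to the rightmost occupied room, so both ends of the
    word are [true] and all rooms outside it are empty. *)
Lemma occupancy_word_reads S i : at_most_one S -> occupied S i ->
  exists2 a, reads S a (occupancy_word S) & tight false (occupancy_word S).
Proof.
move=> hS oi; rewrite /occupancy_word.
have memE y : (y \in sort <=%R (finsupp S : seq int)) = occupied S y.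
  by rewrite mem_sort mem_finsupp_occupied.
have so : sorted <=%R (sort <=%R (finsupp S : seq int)) by exact: sort_le_sorted.
case: sort memE so => [|x s] memE so; first by have := memE i; rewrite oi.
set w := map _ _.
have sz : size w = (`|last x s - x|%N).+1 by rewrite size_map size_iota.
have min y : occupied S y -> x <= y.
  rewrite -memE inE => /orP[/eqP -> //|ys].
  by move: so => /= /order_path_min/allP; apply=> //; exact: le_trans.
have max y : occupied S y -> y <= last x s.
  rewrite -memE => ys; have le_ss := sorted_leq_nth le_trans lexx x so.
  rewrite -[last x s]/(last x (x :: s)) -nth_last -(nth_index x ys).
  have iy : (index y (x :: s) < size (x :: s))%N by rewrite index_mem.
  by apply: le_ss; rewrite ?inE //= -ltnS.
have ox : occupied S x by rewrite -memE mem_head.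
have ol : occupied S (last x s) by rewrite -memE mem_last.
have nthw n : (n < size w)%N -> nth false w n = occupied S (x + n%:Z).
  by move=> h; rewrite (nth_map 0%N) ?nth_iota ?size_iota -?sz.
exists x.
  move=> j; rewrite (occupiedE j hS); congr nat_of_bool; rewrite /window.
  case: ifP => xj; last by apply/negbTE/negP => /min; rewrite xj.
  case: (ltnP `|j - x|%N (size w)) => h.
    by rewrite nthw //; congr occupied; lia.
  rewrite nth_default //; apply/negbTE/negP => /max; move: h; rewrite sz.
  by move: (min _ ol); lia.
apply/andP; split.
  by rewrite -nth0 nthw ?sz // addr0 ox.
rewrite -nth_last sz nthw ?sz //=.
have ->: x + `|last x s - x|%N = last x s by have := min _ ol; lia.
by rewrite ol.
Qed.

Lemma encodes_window S a b w : block_word b = rcons w false ->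
  encodes S a b <-> reads S a w.
Proof.
move=> e; rewrite /encodes /reads e.
by split=> h j; rewrite h window_rcons.
Qed.

Lemma encodes_inj S a a' b b' : tight 0%N b -> tight 0%N b' ->
  encodes S a b -> encodes S a' b' -> b = b'.
Proof.
move=> /block_word_tight[w tw e] /block_word_tight[w' tw' e'].
move=> /(encodes_window S a e) h /(encodes_window S a' e') h'.
have [_ ww'] : a = a' /\ w = w'.
  apply: (window_inj tw tw') => j; have := h' j; rewrite h.
  by do 2!case: (window _ _ _ _).
by apply: block_word_inj; rewrite e e' ww'.
Qed.

Lemma encodes_B S i : at_most_one S -> occupied S i ->
  tight 0%N (entries (B S)) /\ exists a, encodes S a (entries (B S)).
Proof.
move=> hS oi; have [a h t] := occupancy_word_reads hS oi.
split; first exact: suite_word_tight.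
by exists a; apply/(encodes_window S a (block_word_suite_word t)).
Qed.

Lemma encodes_cons0 S a b : encodes S a (0%N :: b) <-> encodes S (a + 1) b.
Proof.
by rewrite /encodes /reads block_word_cons; split=> h j; rewrite h window_cons.
Qed.

Lemma encodes_rcons0 S a b : encodes S a (rcons b 0%N) <-> encodes S a b.
Proof.
rewrite /encodes /reads -cats1 block_word_cat cats1.
by split=> h j; rewrite h window_rcons.
Qed.

Lemma encodes_strip S a o b i : encodes S a b -> occupied S i ->
  exists o' b', [/\ tight 0%N b', exists a', encodes S a' b'
                  & window 0%N o b =1 window 0%N o' b'].
Proof.
have [n] := ubnP (size b); elim: n a o b => // n IH a o b sb h oi.
have [tb|] := boolP (tight 0%N b); first by exists o, b; split=> //; exists a.
have nil : b <> [::].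
  by move=> b0; move: oi; rewrite /occupied h b0 /window nth_nil if_same.
rewrite negb_and !negbK => /orP[].
  case: b sb h nil => // m b sb h _ /eqP /= m0.
  move: sb h; rewrite m0 ltnS => sb /encodes_cons0 h.
  have [o' [b2 [t2 h2 e2]]] := IH _ (o + 1) _ sb h oi.
  by exists o', b2; split=> // j; rewrite window_cons.
case/lastP: b sb h nil => // b m sb h _; rewrite last_rcons => /eqP m0.
move: sb h; rewrite m0 size_rcons ltnS => sb /encodes_rcons0 h.
have [o' [b2 [t2 h2 e2]]] := IH _ o _ sb h oi.
by exists o', b2; split=> // j; rewrite window_rcons.
Qed.

Lemma entryE T q : entry T q = window 0%N (offset T) (entries T) q.
Proof. by []. Qed.

(** Recognises [B S] from any encoding, padded or not: stripping [b] gives a tight sequence, which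
    must agree both with [T] and with the entries of [B S]. *)
Lemma same_suite_B S a o b T i : encodes S a b -> occupied S i ->
  tight 0%N (entries T) -> entry T =1 window 0%N o b -> same_suite T (B S).
Proof.
move=> h oi tT e; have [o' [b' [t' [a' h'] e']]] := encodes_strip o h oi.
have [_ eT] : offset T = o' /\ entries T = b'.
  by apply: (window_inj tT t') => j; rewrite -entryE e e'.
have [tB [a2 h2]] := encodes_B (reads_at_most_one h) oi.
exists (offset T); case: T {tT e} eT => oT bT /= ->.
by rewrite /translate (encodes_inj t' tB h' h2) add0r.
Qed.

(** * Effect of a move on the block word *)

Section Move.
Variables (S : state) (a : int) (c1 c2 : seq nat) (c k d : nat).
Hypothesis hS : encodes S a (c1 ++ [:: c, k, d & c2]).
(** [l] is the separator between the blocks of lengths [c] and [k], and [r] the one between those of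
    lengths [k] and [d]. *)
Let l := a + (size (block_word c1) + c)%N%:Z.
Let r := l + k.+1%:Z.

Let u := block_word c1 ++ nseq c true.
Let v := nseq d true ++ false :: block_word c2.

Let word_before :
  block_word (c1 ++ [:: c, k, d & c2]) = u ++ false :: nseq k true ++ false :: v.
Proof. by rewrite block_word_cat !block_word_cons -!catA. Qed.

Let size_u : size u = (size (block_word c1) + c)%N.
Proof. by rewrite size_cat size_nseq. Qed.

Let nth_before n : nth false (u ++ false :: nseq k true ++ false :: v) n =
  if (n < size u)%N then nth false u n else
  if (n == size u)%N then false else
  if (n <= size u + k)%N then true else
  if (n == size u + k.+1)%N then false else nth false v (n - size u - k.+2)%N.
Proof.
rewrite nth_cat; case: ifP => // h1.
case: eqP => [->|h2]; first by rewrite subnn.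
have -> /= : (n - size u = (n - size u).-1.+1)%N by lia.
rewrite nth_cat size_nseq.
case: ifP => [h3|h3]; [rewrite ifT ?nth_nseq ?h3 //; lia|rewrite ifF; last lia].
case: eqP => [->|h4].
  by have -> : ((size u + k.+1 - size u).-1 - k = 0)%N by lia.
have -> /= : ((n - size u).-1 - k = (n - size u - k.+2).+1)%N by lia.
by congr nth; lia.
Qed.

Let S_nat n : S (a + n%:Z) = nth false (u ++ false :: nseq k true ++ false :: v) n.
Proof. by rewrite hS word_before window_nat. Qed.

Lemma occupied_block j : l < j -> j < r -> occupied S j.
Proof.
move=> lj jr; rewrite /occupied.
have -> : j = a + `|j - a|%N by lia.
have h1 : (size u < `|j - a|)%N by rewrite size_u; lia.
have h2 : (`|j - a| <= size u + k)%N by rewrite size_u; lia.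
by rewrite S_nat nth_before lt0b ltnNge (ltnW h1) /= gtn_eqF // h2.
Qed.

Lemma free_before_block : ~~ occupied S l.
Proof. by rewrite /occupied /l -size_u S_nat nth_before ltnn eqxx. Qed.

Lemma free_after_block : ~~ occupied S r.
Proof.
rewrite /occupied /r /l -size_u -addrA -PoszD S_nat nth_before.
by rewrite lt0b addnS ltnNge ltnW ?ltnS ?leq_addr //= gtn_eqF ?ltnS ?leq_addr //
           ltnn eqxx.
Qed.

Lemma block_nearest_free_left j : l < j -> j < r -> nearest_free_left S j l.
Proof.
move=> lj jr; split; rewrite ?free_before_block // => m lm mj.
by apply: occupied_block => //; lia.
Qed.

Lemma block_nearest_free_right j : l < j -> j < r -> nearest_free_right S j r.
Proof.
move=> lj jr; split; rewrite ?free_after_block // => m lm mj.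
by apply: occupied_block => //; lia.
Qed.

Variables (S' : state) (x : nat).
Hypothesis hx : (0 < x < k)%N.
Let i := l + x%:Z.

Let word_after : block_word (c1 ++ [:: c + x, 0, (k - x) + d & c2]%N)
  = u ++ nseq x true ++ false :: false :: nseq (k - x) true ++ v.
Proof. by rewrite block_word_cat !block_word_cons !nseqD -!catA. Qed.

Let nth_after n :
  nth false (u ++ nseq x true ++ false :: false :: nseq (k - x) true ++ v) n =
  if (n < size u)%N then nth false u n else
  if (n < size u + x)%N then true else
  if (n <= size u + x.+1)%N then false else
  if (n <= size u + k.+1)%N then true else nth false v (n - size u - k.+2)%N.
Proof.
case/andP: hx => x0 xk.
rewrite nth_cat; case: ifP => // h1.
rewrite nth_cat size_nseq.
case: ifP => [h2|h2]; [rewrite ifT ?nth_nseq ?h2 //; lia|rewrite ifF; last lia].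
case: ifP => h3.
  have h4 : (n - size u - x <= 1)%N by lia.
  by case: (n - size u - x)%N h4 => [|[|]].
have -> /= : (n - size u - x = (n - size u - x.+2).+2)%N by lia.
rewrite nth_cat size_nseq.
case: ifP => [h4|h4]; [rewrite ifT ?nth_nseq ?h4 //; lia|rewrite ifF; last lia].
by congr nth; lia.
Qed.

(** Filling [l] joins the block of length [c] to the [x - 1] ones left of [i]; filling [r] joins the
    [k - x - 1] ones right of [i + 1] to the block of length [d]. The vacated rooms [i] and [i + 1]
    are two adjacent separators, enclosing an empty block. *)
Lemma move_encodes :
  (forall j : int, S' j = (S j - (j == i) - (j == i + 1)%R
                             + (j == l) + (j == r))%N) ->
  encodes S' a (c1 ++ [:: c + x, 0, (k - x) + d & c2]%N).
Proof.
case/andP: hx => x0 xk h j; rewrite h word_after.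
have [ja|aj] := ltP j a.
  rewrite hS /window leNgt ja /=; have := size_u; lia.
have [n ->] : exists n : nat, j = a + n%:Z by exists `|j - a|%N; lia.
rewrite window_nat S_nat nth_before nth_after.
have -> : (a + n%:Z == i) = (n == size u + x)%N by rewrite size_u; lia.
have -> : (a + n%:Z == i + 1) = (n == size u + x.+1)%N by rewrite size_u; lia.
have -> : (a + n%:Z == l) = (n == size u)%N by rewrite size_u; lia.
have -> : (a + n%:Z == r) = (n == size u + k.+1)%N by rewrite size_u; lia.
(* Outside the rooms from [l] to [r] the two words agree, so their values there are abstracted and
   only a comparison of [n] with the region boundaries remains. *)
move: (size u) (nth false u n) (nth false v _) => m p q; clear -x0 xk.
case: (ltnP n m) => h1; first by case: p; lia.
case: (n =P m) => h2; first by rewrite ifT; lia.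
case: (ltnP n (m + x)) => h3; first by rewrite ifT; lia.
case: (leqP n (m + x.+1)) => h4; first by rewrite ifT; lia.
case: (leqP n (m + k)) => h5; first by rewrite ifT; lia.
case: (n =P _) => h6; first by rewrite ifT; lia.
by rewrite ifF; [case: q; lia|lia].
Qed.

End Move.

(** * Padding, and suite moves as pointwise transfers *)

Lemma block_word_block b n : nth false (block_word b) n ->
  exists c1 k c2, [/\ b = c1 ++ k :: c2, (size (block_word c1) <= n)%N
                    & (n < size (block_word c1) + k)%N].
Proof.
elim: b n => [|m b IH] n; first by rewrite nth_nil.
rewrite block_word_cons nth_cat size_nseq; case: ltnP => nm.
  by exists [::], m, b.
case: (n - m)%N (subnK nm) => // n' nE /= /IH[c1 [k [c2 [-> h1 h2]]]].
exists (m :: c1), k, c2; rewrite block_word_cons size_cat size_nseq /=.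
by split=> //; lia.
Qed.

(** A positive entry cannot be one of the two padding zeros, so it has a neighbour on each side. *)
Lemma pad_split b c1 k c2 : 0%N :: rcons b 0%N = c1 ++ k :: c2 -> (0 < k)%N ->
  exists c1' c d c2', c1 ++ k :: c2 = c1' ++ [:: c, k, d & c2'] /\
    c1 = rcons c1' c.
Proof.
case/lastP: c1 => [|c1 c]; first by case=> <-.
case: c2 => [|d c2]; last by exists c1, c, d, c2; rewrite cat_rcons.
rewrite -rcons_cons cats1 => /eqP; rewrite eqseq_rcons => /andP[_ /eqP <-] //.
Qed.

Lemma encodes_pad S a b : encodes S a b -> encodes S (a - 1) (0%N :: rcons b 0%N).
Proof. by move=> h; apply/encodes_cons0; rewrite subrK; apply/encodes_rcons0. Qed.

Lemma entry_pad T :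
  entry T =1 window 0%N (offset T - 1) (0%N :: rcons (entries T) 0%N).
Proof. by move=> q; rewrite window_cons subrK window_rcons. Qed.

(** The pointwise clause of [suite_move], separated from the conditions on the two ends so that it
    can be checked on padded sequences. *)
Definition transfers (e e' : int -> nat) (p : int) (k x : nat) :=
  forall q : int, e' q =
    if q == p then 0%N
    else if q == p - 1 then (e q + x)%N
    else if q == p + 1 then (e q + (k - x))%N
    else e q.

Lemma window_mid (o : int) c1 (c k d : nat) c2 :
  window 0%N o (c1 ++ [:: c, k, d & c2]) (o + (size c1).+1%:Z) = k.
Proof. by rewrite window_nat nth_cat ltnNge leqnSn /= subSn // subnn. Qed.

Lemma window_transfers (o : int) c1 (c k d x : nat) c2 :
  transfers (window 0%N o (c1 ++ [:: c, k, d & c2]))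
    (window 0%N o (c1 ++ [:: c + x, 0, k - x + d & c2]%N))
    (o + (size c1).+1%:Z) k x.
Proof.
move=> q; have [qo|oq] := ltP q o.
  by rewrite /window !(lt_geF qo) !ifF //; lia.
have [n ->] : exists n : nat, q = o + n%:Z by exists `|q - o|%N; lia.
rewrite !window_nat !nth_cat; set m := size c1.
have [nm|mn] := ltnP n m; first by rewrite !ifF //; lia.
have [r ->] : exists r, n = (m + r)%N by exists (n - m)%N; lia.
have -> : (o + (m + r)%N == o + m.+1) = (r == 1)%N by lia.
have -> : (o + (m + r)%N == o + m.+1 - 1) = (r == 0)%N by lia.
have -> : (o + (m + r)%N == o + m.+1 + 1) = (r == 2)%N by lia.
by rewrite addKn; case: r => [|[|[|r]]] //=; rewrite addnC.
Qed.

(** * Tightness and the ends of a suite after a move *)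

Section SuiteMove.
Variables (T T' : suite) (p : int) (k x : nat).
Hypotheses (tT : tight 0%N (entries T)) (pk : entry T p = k).
Hypotheses (hx : (0 < x < k)%N) (tr : transfers (entry T) (entry T') p k x).

Let entry_l : (0 < entry T' (p - 1))%N.
Proof. by rewrite tr ifF ?ifT //; lia. Qed.

Let entry_r : (0 < entry T' (p + 1))%N.
Proof. by rewrite tr eqxx; do 2![case: eqP => [|_]; first lia]; lia. Qed.

Let entry_other q : q != p -> (0 < entry T q)%N -> (0 < entry T' q)%N.
Proof. by move=> /negbTE qp q0; rewrite tr qp; do 2?case: ifP; lia. Qed.

Let p_bounds : offset T <= p < suite_end T.
Proof. by apply: (@window_neq _ 0%N); rewrite -entryE pk; lia. Qed.

Let entry_support q : (0 < entry T' q)%N ->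
  [\/ q = p - 1, q = p + 1 | offset T <= q < suite_end T].
Proof.
rewrite tr; case: eqP => // _; case: eqP => [-> _|_]; first by constructor 1.
case: eqP => [-> _|_ q0]; first by constructor 2.
by constructor 3; apply: (@window_neq _ 0%N); rewrite -entryE; lia.
Qed.

Let first_entry : (0 < entry T (offset T))%N.
Proof. by rewrite lt0n; apply: tight_offset. Qed.

Let last_entry : (0 < entry T (suite_end T - 1))%N.
Proof. by rewrite lt0n; apply: tight_end. Qed.

(** Each end of [T'] is either a neighbour of [p], which has received a positive amount, or an old
    end other than [p], which has not been emptied. *)
Lemma transfers_tight :
  offset T' = Order.min (offset T) (p - 1) ->
  suite_end T' = Order.max (suite_end T) (p + 2) -> tight 0%N (entries T').
Proof.
move=> eo ee; apply: (@tight_window _ _ (offset T')).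
  rewrite -entryE -lt0n eo; case: (ltP (offset T) (p - 1)) => h.
    by rewrite entry_other //; lia.
  exact: entry_l.
rewrite -/(suite_end T') -entryE -lt0n ee.
case: (ltP (suite_end T) (p + 2)) => h.
  by have -> : p + 2 - 1 = p + 1 by lia.
by rewrite entry_other //; lia.
Qed.

(** Tightness places the ends of [T'] at the extremes of its support. That support contains [p - 1],
    [p + 1] and every old end other than [p], and apart from [p - 1] and [p + 1] it stays within the
    range of [T]; this forces the required minimum and maximum. *)
Lemma tight_suite_move : tight 0%N (entries T') -> suite_move T T'.
Proof.
move=> tT'; exists p, k, x; split=> //; first by lia.
have bounds q : (0 < entry T' q)%N -> offset T' <= q < suite_end T'.
  by rewrite lt0n => /window_neq.
have h1 := bounds _ entry_l; have h2 := bounds _ entry_r.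
have h3 : [\/ offset T' = p - 1, offset T' = p + 1 |
              offset T <= offset T' < suite_end T].
  by apply: entry_support; rewrite lt0n; apply: tight_offset.
have h4 : [\/ suite_end T' - 1 = p - 1, suite_end T' - 1 = p + 1 |
              offset T <= suite_end T' - 1 < suite_end T].
  by apply: entry_support; rewrite lt0n; apply: tight_end.
have h5 : offset T != p -> offset T' <= offset T < suite_end T'.
  by move=> /entry_other h; apply: bounds; apply: h.
have h6 : suite_end T - 1 != p -> offset T' <= suite_end T - 1 < suite_end T'.
  by move=> /entry_other h; apply: bounds; apply: h.
move: p_bounds; split.
  by case: (ltP (offset T) (p - 1)) => h; case: h3; lia.
by case: (ltP (suite_end T) (p + 2)) => h; case: h4; lia.
Qed.

End SuiteMove.

(* The first entry decreases only when the move takes place there, and then the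
   sequence grows to the left. *)
Lemma suite_move_offset T T' : suite_move T T' ->
  offset T' = if (head 0 (entries T') < head 0 (entries T))%N
              then offset T - 1 else offset T.
Proof.
have entry_offset U : head 0%N (entries U) = entry U (offset U).
  by rewrite entryE -{2}[offset U]addr0 window_nat nth0.
move=> [p [k [x [pk k1 hx [eo _] tr]]]]; rewrite !entry_offset.
have pT : offset T <= p < suite_end T.
  by apply: (@window_neq _ 0%N); rewrite -entryE pk; lia.
case: (ltP (offset T) p) => h.
  have {}eo : offset T' = offset T by lia.
  have le : (entry T (offset T) <= entry T' (offset T))%N.
    by rewrite tr ifF; [do 2?case: ifP; lia | lia].
  by rewrite eo ltnNge le.
have op : offset T = p by lia.
have e0 : entry T (p - 1) = 0%N by rewrite /entry ifF //; lia.
have {}eo : offset T' = p - 1 by lia.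
rewrite eo.
have -> : entry T' (p - 1) = x by rewrite tr e0 eqxx ifF //; lia.
by rewrite op pk ifT //; lia.
Qed.

(** [B] fixes a suite only up to translation, but centroids depend on positions. Here the entries
    after the move determine the offset, which removes the ambiguity. *)
Lemma suite_move_inj T T1 T2 :
  suite_move T T1 -> suite_move T T2 -> entries T1 = entries T2 -> T1 = T2.
Proof.
move=> /suite_move_offset + /suite_move_offset +.
by case: T1 T2 => o1 b [o2 b'] /= -> -> ->.
Qed.

(** * Totals and first moments under moves *)

Lemma sum_support (R : nmodType) (I : eqType) (g : I -> R) (A A' : seq I) :
  uniq A -> uniq A' -> (forall j, g j != 0 -> j \in A) ->
  (forall j, g j != 0 -> j \in A') -> \sum_(j <- A) g j = \sum_(j <- A') g j.
Proof.
move=> uA uA' hA hA'.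
have nz (C : seq I) : \sum_(j <- C) g j = \sum_(j <- [seq j <- C | g j != 0]) g j.
  by rewrite big_filter [LHS](bigID (fun j => g j != 0)) /= [X in _ + X]big1
       ?addr0 // => j /negbNE /eqP.
rewrite (nz A) (nz A'); apply/perm_big/uniq_perm; rewrite ?filter_uniq // => j.
by rewrite !mem_filter; case: eqP => //= /eqP gj; rewrite hA ?hA'.
Qed.

Lemma sum_indicator (R : pzSemiRingType) (I : eqType) (f : I -> R) (A : seq I) i :
  uniq A -> i \in A -> \sum_(j <- A) (j == i)%:R * f j = f i.
Proof.
move=> uA iA; rewrite (bigD1_seq i) //= eqxx mul1r big1 ?addr0 // => j ji.
by rewrite (negbTE ji) mul0r.
Qed.

(** Covers both kinds of move: amounts [m1], [m2] leave [i1], [i2] and amounts [n1], [n2] arrive at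
    [l], [r]. Losses are added on the other side to avoid truncated subtraction. Constant [f = 1]
    gives totals, and [f = intr] gives first moments. *)
Lemma sum_exchange (e e' : int -> nat) (A A' : seq int) (f : int -> rat)
    (i1 i2 l r : int) (m1 m2 n1 n2 : nat) :
  uniq A -> uniq A' -> (forall j, e j != 0%N -> j \in A) ->
  (forall j, e' j != 0%N -> j \in A') ->
  (forall j, e' j + m1 * (j == i1) + m2 * (j == i2)
             = e j + n1 * (j == l) + n2 * (j == r))%N ->
  \sum_(j <- A') (e' j)%:R * f j + m1%:R * f i1 + m2%:R * f i2
  = \sum_(j <- A) (e j)%:R * f j + n1%:R * f l + n2%:R * f r.
Proof.
move=> uA uA' hA hA' h.
(* A common index set containing both ranges of summation and the four affected points. *)
pose D := undup (A ++ A' ++ [:: i1; i2; l; r]).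
have uD : uniq D by rewrite undup_uniq.
have suppD (g : int -> nat) C : uniq C -> (forall j, g j != 0%N -> j \in C) ->
    {subset C <= D} ->
    \sum_(j <- C) (g j)%:R * f j = \sum_(j <- D) (g j)%:R * f j.
  move=> uC hC CD.
  have nz j : (g j)%:R * f j != 0 -> j \in C.
    by move=> gj; apply: hC; apply: contraNneq gj => ->; rewrite mul0r.
  by apply: sum_support => // j /nz /CD.
rewrite (suppD e A) //; last by move=> j jA; rewrite mem_undup mem_cat jA.
rewrite (suppD e' A') //; last first.
  by move=> j jA; rewrite mem_undup !mem_cat jA orbT.
have ind (n : nat) i : i \in [:: i1; i2; l; r] ->
    n%:R * f i = \sum_(j <- D) (n * (j == i))%:R * f j.
  move=> iD; rewrite -(sum_indicator f uD (i := i)); last first.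
    by rewrite mem_undup !mem_cat iD !orbT.
  by rewrite mulr_sumr; apply: eq_bigr => j _; rewrite natrM mulrA.
rewrite !ind ?inE ?eqxx ?orbT // -!big_split /=; apply: eq_bigr => j _.
by rewrite -!mulrDl -!natrD h.
Qed.

Definition suite_range (T : suite) : seq int :=
  [seq offset T + k%:Z | k <- iota 0 (size (entries T))].

Lemma suite_range_uniq T : uniq (suite_range T).
Proof. by rewrite map_inj_uniq ?iota_uniq // => m n /addrI []. Qed.

Lemma suite_rangeP T q : entry T q != 0%N -> q \in suite_range T.
Proof.
rewrite entryE => /window_neq; rewrite -[_ + _]/(suite_end T) /suite_end => h.
by apply/mapP; exists `|q - offset T|%N; [rewrite mem_iota; lia | lia].
Qed.

Lemma suite_sum (f : int -> rat) T :
  \sum_(k < size (entries T)) (nth 0%N (entries T) k)%:R * f (offset T + k%:Z)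
  = \sum_(q <- suite_range T) (entry T q)%:R * f q.
Proof.
rewrite big_map -[X in iota 0 X]subn0 -/(index_iota 0 _) big_mkord.
by apply: eq_bigr => k _; rewrite entryE window_nat.
Qed.

Lemma suite_centroidE T : suite_centroid T =
  (\sum_(q <- suite_range T) (entry T q)%:R * q%:~R) / (suite_total T)%:R.
Proof. by congr (_ / _); exact: (suite_sum intr). Qed.

Lemma suite_totalE T :
  (suite_total T)%:R = \sum_(q <- suite_range T) (entry T q)%:R * 1 :> rat.
Proof.
rewrite -(suite_sum (fun=> 1)) /suite_total sumnE (big_nth 0%N) big_mkord natr_sum.
by apply: eq_bigr => k _; rewrite mulr1.
Qed.

Lemma violinistsE S :
  (violinists S)%:R = \sum_(j <- finsupp S) (S j)%:R * 1 :> rat.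
Proof. by rewrite natr_sum; apply: eq_bigr => j _; rewrite mulr1. Qed.

Lemma violinists_encodes S a b : encodes S a b -> violinists S = sumn b.
Proof.
move=> h; rewrite -count_block_word /violinists.
pose A := [seq a + n%:Z | n <- iota 0 (size (block_word b))].
have -> : (\sum_(j <- finsupp S) S j = \sum_(j <- A) S j)%N.
  apply: (@sum_support nat _ S); rewrite ?fset_uniq //.
  - by rewrite map_inj_uniq ?iota_uniq // => m n /addrI [].
  - by move=> j; rewrite mem_finsupp.
  move=> j; rewrite h => hj.
  have aj : a <= j < a + (size (block_word b))%:Z.
    by apply: (@window_neq _ false); case: (window _ _ _ _) hj.
  by apply/mapP; exists `|j - a|%N; [rewrite mem_iota; lia | lia].
rewrite big_map -[X in iota 0 X]subn0 -/(index_iota 0 _) -sum1_count.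
rewrite [RHS](big_nth false) [RHS]big_mkcond /=; apply: eq_bigr => n _.
by rewrite h window_nat; case: (nth _ _ _).
Qed.

Lemma same_suiteE T S : same_suite T (B S) -> entries T = entries (B S).
Proof. by case=> c ->. Qed.

(** * Correspondence of moves in both directions *)

Lemma move_block S S' T : at_most_one S -> move S S' -> same_suite T (B S) ->
  exists (i l r p : int) (k x : nat) T',
    [/\ [/\ suite_move T T', same_suite T' (B S') & entry T p = k],
        (0 < x < k)%N, transfers (entry T) (entry T') p k x,
        l + r - i - (i + 1) = k%:Z - x%:Z - x%:Z &
        forall j, S' j + (j == i) + (j == i + 1)%R
                  = S j + (j == l) + (j == r) :> nat].
Proof.
move=> hS [i [l [r [oi oi1 [li fl ol] [ir fr or] hS']]]] sT.
have [tb [a0 h0]] := encodes_B hS oi.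
have eT := same_suiteE sT; rewrite -eT in tb h0.
have := encodes_pad h0; set a := a0 - 1 => ha.
have [c1 [k [c2 [eb n1 n2]]]] : exists c1 k c2,
    [/\ 0%N :: rcons (entries T) 0%N = c1 ++ k :: c2,
        a + size (block_word c1) <= i & i < a + (size (block_word c1) + k)%N].
  have := oi; rewrite /occupied ha lt0b => w.
  have := @window_neq _ false a (block_word (0%N :: rcons (entries T) 0%N)) i.
  rewrite w => /(_ isT) ai.
  have ei : i = a + `|i - a|%N by lia.
  move: w; rewrite {1}ei window_nat => /block_word_block[c1 [k [c2 [e n1 n2]]]].
  by exists c1, k, c2; split=> //; lia.
have k0 : (0 < k)%N by lia.
have [c1' [c [d [c2' [e e1]]]]] := pad_split eb k0.
move: n1 n2; rewrite e1 -cats1 block_word_cat block_word_cons cats1 size_cat.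
rewrite size_rcons size_nseq addnS => n1 n2.
rewrite eb e in ha.
have blk := occupied_block ha; have f0 := free_before_block ha.
have f1 := free_after_block ha.
set l' := a + (size (block_word c1') + c)%N in blk f0 f1.
(* Both are free rooms left of [i] with only occupied rooms between them and [i], so neither can lie
   strictly inside the other's gap. *)
have ll : l = l'.
  have [lt|gt|//] := ltgtP l l'.
    by move: f0; rewrite ol //; lia.
  by move: fl; rewrite blk //; lia.
(* Room [i + 1] is occupied and the separator is free, so [i + 1] still lies in the block; this
   gives [x < k]. *)
have i1r : i + 1 != l' + k.+1 by apply: contraNneq f1 => <-.
have rr : r = l' + k.+1%:Z.
  have [lt|gt|//] := ltgtP r (l' + k.+1%:Z).
    by move: fr; rewrite blk //; lia.
  by move: f1; rewrite or //; lia.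
pose x := `|i - l|%N.
have hx : (0 < x < k)%N by lia.
have ix : i = l' + x%:Z by lia.
have hS2 : encodes S' a (c1' ++ [:: c + x, 0, k - x + d & c2']%N).
  by apply: (move_encodes ha hx) => j; rewrite -/l' -ix -ll hS' rr -ll.
(* The padding zero on the left starts the sequence one position before [T]. *)
have tr := @window_transfers (offset T - 1) c1' c k d x c2'.
have mid := @window_mid (offset T - 1) c1' c k d c2'.
have ol2 : occupied S' l by rewrite /occupied hS' eqxx; lia.
have [o' [b' [t' _ e']]] := encodes_strip (offset T - 1) hS2 ol2.
set p := offset T - 1 + _ in mid tr.
have eTp q : entry T q = window 0%N (offset T - 1) (c1' ++ [:: c, k, d & c2']) q.
  by rewrite entry_pad eb e.
have tr' : transfers (entry T) (entry (Suite o' b')) p k x.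
  by move=> q; rewrite [LHS]entryE -e' tr !eTp.
exists i, l, r, p, k, x, (Suite o' b'); split=> //.
- split; last by rewrite eTp.
    by apply: (tight_suite_move tb _ hx tr') => //; rewrite eTp.
  by apply: (same_suite_B hS2 ol2) => // q; rewrite entryE -e'.
- by lia.
move=> j; rewrite hS'.
have [-> |_] := eqVneq j i.
  by move: oi; rewrite /occupied; lia.
have [-> |_] := eqVneq j (i + 1).
  by move: oi1; rewrite /occupied; lia.
by lia.
Qed.

Lemma suite_move_move S T T' : at_most_one S -> same_suite T (B S) ->
  suite_move T T' -> exists S', move S S' /\ same_suite T' (B S').
Proof.
move=> hS sT [p [k [x [pk k1 hx [eo ee] tr]]]].
have eT := same_suiteE sT.
(* An empty state would leave [T] without entries, contradicting [k > 1]. *)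
have [i oi] : exists i, occupied S i.
  move: eT; rewrite /= /occupancy_word.
  have memE y : (y \in sort <=%R (finsupp S : seq int)) = occupied S y.
    by rewrite mem_sort mem_finsupp_occupied.
  case: sort memE => [|y s] memE eT; last by exists y; rewrite -memE mem_head.
  by move: k1; rewrite -pk /entry eT nth_nil if_same.
have [tb [a0 h0]] := encodes_B hS oi.
rewrite -eT in tb h0.
have := encodes_pad h0; set a := a0 - 1 => ha.
have tT' := transfers_tight tb pk hx tr eo ee.
have pT : offset T <= p < suite_end T.
  by apply: (@window_neq _ 0%N); rewrite -entryE pk; lia.
(* The successor accounts for the padding zero in front of the entries of [T]. *)
pose n := `|p - offset T|%N.+1; pose b := 0%N :: rcons (entries T) 0%N.
have sn : (n < size b)%N by move: pT; rewrite /= size_rcons /suite_end; lia.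
have pn : p = offset T - 1 + n%:Z by lia.
have bn : nth 0%N b n = k by rewrite -pk entry_pad pn window_nat.
have eb : b = take n b ++ k :: drop n.+1 b.
  by rewrite -bn -drop_nth // cat_take_drop.
have [c1 [c [d [c2 [e e1]]]]] := pad_split eb (ltnW k1).
have n1 : n = (size c1).+1.
  by rewrite -(size_rcons c1 c) -e1 size_take sn.
rewrite -/b eb e in ha.
have blk := occupied_block ha; have nl := block_nearest_free_left ha.
have nr := block_nearest_free_right ha.
set l := a + (size (block_word c1) + c)%N in blk nl nr.
set r := l + k.+1%:Z in blk nl nr.
(* The [x]-th room of the block: since [0 < x < k], both it and the next room belong to the
   block. *)
pose i' := l + x%:Z.
pose S' : state := [fsfun S with i' |-> 0%N, (i' + 1) |-> 0%N,
                                   l |-> 1%N, r |-> 1%N].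
have fl : S l = 0%N by have := free_before_block ha; rewrite /occupied -/l; lia.
have fr : S r = 0%N by have := free_after_block ha; rewrite /occupied -/l -/r; lia.
have oi' : occupied S i' by apply: blk; lia.
have oi1 : occupied S (i' + 1) by apply: blk; lia.
have hS' j : S' j = (S j - (j == i') - (j == i' + 1)%R + (j == l) + (j == r))%N.
  rewrite !fsfun_withE.
  have := hS i'; have := hS (i' + 1) => s1 s2.
  have [-> |ni] := eqVneq j i'; first by lia.
  have [-> |ni1] := eqVneq j (i' + 1); first by lia.
  have [-> |nl'] := eqVneq j l; first by lia.
  by have [-> |nr'] := eqVneq j r; lia.
exists S'; split.
  exists i', l, r; split=> //.
    by apply: nl; lia.
  by apply: nr; lia.
have hS2 := move_encodes ha hx hS'.
have ol : occupied S' l by rewrite /occupied hS' eqxx; lia.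
apply: (same_suite_B (o := offset T - 1) hS2 ol tT') => q.
rewrite tr (window_transfers _ c1 c k d x c2) -n1 -pn -e -eb.
by rewrite -!entry_pad.
Qed.

Theorem theorem4p4 (S1 : state) (hS1 : at_most_one S1) :
  [/\ (forall S2 : state, move S1 S2 ->
         forall T1 : suite, same_suite T1 (B S1) ->
         exists T2 : suite, suite_move T1 T2 /\ same_suite T2 (B S2)),
      (forall T1 T2 : suite, same_suite T1 (B S1) -> suite_move T1 T2 ->
         exists S2 : state, move S1 S2 /\ same_suite T2 (B S2)) &
      (forall S2 : state, move S1 S2 ->
         forall T1 T2 : suite, same_suite T1 (B S1) -> same_suite T2 (B S2) ->
         suite_move T1 T2 ->
         centroid S2 - centroid S1 = suite_centroid T2 - suite_centroid T1)].
Proof.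
split.
- move=> S2 m T1 sT.
  by have [i [l [r [p [k [x [T2 [[? ? _] _ _ _ _]]]]]]]] :=
    move_block hS1 m sT; exists T2.
- by move=> T1 T2; apply: suite_move_move.
move=> S2 m T1 T2 sT1 sT2 mT.
have [i [l [r [p [k [x [T' [[mT' sT' pk] hx tr d hS]]]]]]]] := move_block hS1 m sT1.
(* The given suite move is identified with the one built from the move of violinists. *)
have {mT sT2} e : T2 = T'.
  by apply: suite_move_inj mT mT' _; rewrite (same_suiteE sT2) (same_suiteE sT').
rewrite {}e {T2 sT' mT'}.
have supp (S : state) j : S j != 0%N -> j \in finsupp S by rewrite mem_finsupp.
have mv j : (S2 j + 1 * (j == i) + 1 * (j == i + 1)%R
             = S1 j + 1 * (j == l) + 1 * (j == r))%N by rewrite !mul1n.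
(* A suite move has a single source, so the second source gets weight [0]. *)
have tr' j : (entry T' j + k * (j == p) + 0 * (j == p)
              = entry T1 j + x * (j == p - 1)%R + (k - x) * (j == p + 1)%R)%N.
  rewrite tr; have [->|jp] := eqVneq j p; first by lia.
  by have [->|jl] := eqVneq j (p - 1); [lia | case: eqP; lia].
have sums f := sum_exchange f (fset_uniq _) (fset_uniq _) (supp S1) (supp S2) mv.
have tsums f := sum_exchange f (suite_range_uniq T1) (suite_range_uniq T')
  (@suite_rangeP T1) (@suite_rangeP T') tr'.
have xk : (x <= k)%N by lia.
have N1 : violinists S1 = suite_total T1.
  have [j [_ [_ [oj _ _ _ _]]]] := m.
  have [_ [a h]] := encodes_B hS1 oj.
  by rewrite (violinists_encodes h) /suite_total (same_suiteE sT1).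
have N2 : (violinists S2)%:R = (suite_total T1)%:R :> rat.
  by have := sums (fun=> 1); rewrite -!violinistsE !mulr1 -N1 => /addIr /addIr.
have N2' : (suite_total T')%:R = (suite_total T1)%:R :> rat.
  have := tsums (fun=> 1); rewrite -!suite_totalE !mulr1 mulr0n -[in RHS]addrA.
  by rewrite natrB // [x%:R + _]addrC subrK addr0 => /addIr.
(* All four denominators are the same total, so only first moments remain to be compared. *)
rewrite /centroid !suite_centroidE N2 N2' N1.
rewrite -!mulrBl; congr (_ / _).
have := sums intr; have := tsums intr.
move: d => /(congr1 (fun z : int => z%:~R : rat)).
rewrite natrB //.
set W1 := \sum_(_ <- finsupp S1) _; set W2 := \sum_(_ <- finsupp S2) _.
set V1 := \sum_(_ <- suite_range T1) _; set V2 := \sum_(_ <- suite_range T') _.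
(* The terms in [p] cancel in [hV], leaving [V2 - V1 = k - 2x]; by [d] and [hW] this is also
   [W2 - W1]. *)
rewrite !(rmorphB, rmorphD) /= !pmulrn => d hV hW.
by lra.
Qed.
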